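(* Let $L$ and $h>0$ be as in the context, and suppose $L$ is generic in the following sense: there is exactly one discrete Mather measure $\mu_h$ for $L$, and $\pi_1(\operatorname{supp}(\mu_h))=\Omega_h(L)$. Then there is, up to an additive constant, exactly one calibrated subaction for $L$, i.e. exactly one continuous function $u:\mathbb{T}^N\to\mathbb{R}$ (up to constants) with $$u(x)=\inf_{v\in\mathbb{R}^N}\{u(x+hv)+hL(x,v)-h\overline H_h\}\quad\text{for all }x\in\mathbb{T}^N.$$
   Context: $\mathbb{T}^N=\mathbb{R}^N/\mathbb{Z}^N$; functions on $\mathbb{T}^N$ are identified with $\mathbb{Z}^N$-periodic functions on $\mathbb{R}^N$; $\pi_1:\mathbb{T}^N\times\mathbb{R}^N\to\mathbb{T}^N$ is the projection to the first factor. The Lagrangian $L:\mathbb{R}^N\times\mathbb{R}^N\to\mathbb{R}$ is of class $C^2$, $\mathbb{Z}^N$-periodic in $x$, and satisfies: (1) $\lim_{|v|\to\infty}L(x,v)/|v|=+\infty$ uniformly in $x$; (2) the Hessian $\left(\partial^2L/\partial v_i\partial v_j\right)(x,v)$ is positive definite; (3) there are constants $C,\Gamma>0$ with $L(x+y,v-z)+L(x-y,v+z)-2L(x,v)\le C|y|^2+\Gamma|z|^2$ for all $x,y,v,z$. Moreover $L_x$ is Lipschitz in $v$ with bounded Lipschitz constant. $\mathcal M_h$ is the set of Borel probability measures $\mu$ on $\mathbb{T}^N\times\mathbb{R}^N$ with $\int(\varphi(x+hv)-\varphi(x))\,d\mu=0$ for all $\varphi\in C(\mathbb{T}^N)$,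 and $\overline H_h=\min_{\mu\in\mathcal M_h}\int L\,d\mu$. A discrete Mather measure is a $\mu_h\in\mathcal M_h$ attaining this minimum. $h>0$ is fixed and small enough that the graph property holds: every discrete Mather measure is supported on a Lipschitz graph $\{(x,v(x))\}$. A $k$-path from $x$ to $z$ ($x,z\in\mathbb{R}^N$) is a sequence $(x_0,\dots,x_k)$ in $\mathbb{R}^N$ with $x_0=x$, $x_k=z$; put $v_j=(x_{j+1}-x_j)/h$. Its action is $A_{L-\overline H_h}(x_0,\dots,x_k)=h\sum_{i=0}^{k-1}(L(x_i,v_i)-\overline H_h)$. A point $x\in\mathbb{T}^N$ is non-wandering with respect to $L$ if for every $\epsilon>0$ there are $k\ge1$, $s\in\mathbb{Z}^N$ and a $k$-path $(x_0,\dots,x_k)$ from $x+s$ to $x$ with $|A_{L-\overline H_h}(x_0,\dots,x_k)|<\epsilon$. $\Omega_h(L)$ is the set of non-wandering points. *)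

(* Defs.v *)
From HB Require Import structures.
From mathcomp Require Import all_boot all_order all_algebra.
From mathcomp Require Export all_classical all_reals all_analysis.

Set Implicit Arguments.
Unset Strict Implicit.
Unset Printing Implicit Defensive.
Import Order.TTheory GRing.Theory Num.Theory.
Import numFieldNormedType.Exports.
Local Open Scope classical_set_scope.
Local Open Scope ring_scope.
Local Open Scope quotient_scope.

Section Torus.
Variables (R : realType) (N : nat).

Definition Zlattice : {pred 'rV[R]_N} := mxOver Num.int.

Fact Zlattice_zmod_closed : zmod_closed Zlattice.
Proof.
split=> [|x y /mxOverP xZ /mxOverP yZ]; first by rewrite mxOver0 // rpred0.
by apply/mxOverP => i j; rewrite !mxE rpredB.
Qed.

HB.instance Definition _ :=
  GRing.isZmodClosed.Build 'rV[R]_N Zlattice Zlattice_zmod_closed.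

Definition torus := quotient_topology {ideal_quot Zlattice}.

Definition translate (x : torus) (w : 'rV[R]_N) : torus := \pi_torus (repr x + w).

Definition phase := g_sigma_algebraType (@open (torus * 'rV[R]_N)%type).

Definition msupport (mu : probability phase R) : set (torus * 'rV[R]_N) :=
  [set z | forall U : set (torus * 'rV[R]_N), open_nbhs z U -> (0 < mu U)%E].

(* The norm instance of the library on row vectors is the sup norm. *)
Definition enorm (x : 'rV[R]_N) : R := Num.sqrt (\sum_(i < N) x 0 i ^+ 2).

End Torus.

Arguments Zlattice R N : clear implicits.

Section Smoothness.
Variables (R : realType) (V : normedModType R).

Definition C1 (f : V -> R) :=
  (forall z, differentiable f z) /\ (forall w, continuous ('D_w f)).

Definition C2 (f : V -> R) := C1 f /\ (forall w, C1 ('D_w f)).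

End Smoothness.

Section Lagrangian.
Variables (R : realType) (N : nat).
Variable L : 'rV[R]_N * 'rV[R]_N -> R.

Definition periodic_in_x :=
  forall (x v s : 'rV[R]_N), s \in Zlattice R N -> L (x + s, v) = L (x, v).

Definition superlinear :=
  forall A : R, exists r : R, forall x v, r < enorm v -> A < L (x, v) / enorm v.

Definition partial_x (i : 'I_N) : 'rV[R]_N * 'rV[R]_N -> R :=
  'D_(delta_mx 0 i, 0) L.

Definition partial_v (i : 'I_N) : 'rV[R]_N * 'rV[R]_N -> R :=
  'D_(0, delta_mx 0 i) L.

Definition grad_x (z : 'rV[R]_N * 'rV[R]_N) : 'rV[R]_N :=
  \row_i partial_x i z.

Definition hessian_v (z : 'rV[R]_N * 'rV[R]_N) : 'M[R]_N :=
  \matrix_(i, j) 'D_(0, delta_mx 0 i) (partial_v j) z.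

Definition hessian_v_posdef :=
  forall z (w : 'rV[R]_N), w != 0 -> 0 < (w *m hessian_v z *m w^T) 0 0.

Definition semiconcave :=
  exists C Gamma : R, [/\ 0 < C, 0 < Gamma &
    forall x v y z : 'rV[R]_N,
      L (x + y, v - z) + L (x - y, v + z) - 2 * L (x, v)
        <= C * enorm y ^+ 2 + Gamma * enorm z ^+ 2].

Definition grad_x_lipschitz_in_v :=
  exists K : R, forall x v w : 'rV[R]_N,
    enorm (grad_x (x, v) - grad_x (x, w)) <= K * enorm (v - w).

(* L seen as a function on T^N x R^N; the choice of the representative is
   immaterial when L is periodic in x. *)
Definition torusL (z : torus R N * 'rV[R]_N) : R := L (repr z.1, z.2).

Variable h : R.

Definition holonomic (mu : probability (phase R N) R) :=
  forall phi : torus R N -> R, continuous phi ->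
    (\int[mu]_z (phi (translate z.1 (h *: z.2)) - phi z.1)%:E = 0)%E.

(* For a superlinear L the negative part of L is bounded, so that this integral
   is well defined in ]-oo, +oo]. *)
Definition mean_action (mu : probability (phase R N) R) : \bar R :=
  (\int[mu]_z (torusL z)%:E)%E.

(* The infimum is finite for a continuous superlinear periodic L (the Dirac
   mass at (0, 0) is holonomic), so fine is harmless. *)
Definition Hbar : R :=
  fine (ereal_inf [set mean_action mu | mu in [set mu | holonomic mu]]).

Definition mather_measure (mu : probability (phase R N) R) :=
  holonomic mu /\ forall nu, holonomic nu -> (mean_action mu <= mean_action nu)%E.

(* The Lipschitz bound is against the distance of T^N: it is required for all
   lifts x, y to R^N of the two points. *)
Definition graph_property :=
  forall mu, mather_measure mu ->
    exists (g : torus R N -> 'rV[R]_N) (K : R),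
      (forall z, msupport mu z -> z.2 = g z.1) /\
      (forall x y : 'rV[R]_N,
         (fst @` msupport mu) (\pi_(torus R N) x) ->
         (fst @` msupport mu) (\pi_(torus R N) y) ->
         enorm (g (\pi_(torus R N) x) - g (\pi_(torus R N) y))
           <= K * enorm (x - y)).

(* A k-path is given by p 0, ..., p k; the other values of p are irrelevant. *)
Definition path_action (k : nat) (p : nat -> 'rV[R]_N) : R :=
  h * \sum_(i < k) (L (p i, h^-1 *: (p i.+1 - p i)) - Hbar).

Definition nonwandering : set (torus R N) :=
  [set x | forall eps : R, 0 < eps ->
    exists (k : nat) (s : 'rV[R]_N) (p : nat -> 'rV[R]_N),
      [/\ (1 <= k)%N, s \in Zlattice R N, p 0%N = repr x + s, p k = repr x
        & `|path_action k p| < eps]].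

Definition calibrated_subaction (u : torus R N -> R) :=
  continuous u /\
  forall x : torus R N,
    ((u x)%:E = ereal_inf [set (u (translate x (h *: v)) + h * torusL (x, v)
                                - h * Hbar)%:E | v in [set: 'rV[R]_N]])%E.

End Lagrangian.

(* Main.v *)
(* Write c(a, b) = h (L(a, (b - a)/h) - Hbar) for the cost of one step of a path.
   Cycles on the torus have nonnegative action, because the empirical measure of
   a cycle is holonomic.  Hence, for a nonwandering z, the infimum of the actions
   of the paths from a to z is a finite function of a, which vanishes at z and is
   therefore a fixed point of the Lax-Oleinik operator: this gives existence.

   If u and w are calibrated, then h L - h Hbar = u(x) - u(x + hv) mu-a.e. and
   similarly for w, so that d = u - w is mu-a.e. invariant under (x, v) |-> x + hv.
   Every probability density that is a function of d therefore turns mu into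
   another Mather measure, and uniqueness of mu forces d to be constant on the
   projected support, which is the nonwandering set.  Finally, w - u is
   nondecreasing along a u-calibrated orbit, which clusters at a nonwandering
   point; so w - u is everywhere at most this constant, and by symmetry equal. *)

From HB Require Import structures.
Require Import Defs.
From mathcomp Require Import all_boot all_order all_algebra.
From mathcomp Require Import all_classical all_reals all_analysis.
From mathcomp Require Import measurable_realfun lra.
Import Order.TTheory GRing.Theory Num.Theory.
Import numFieldNormedType.Exports.
Local Open Scope classical_set_scope.
Local Open Scope ring_scope.

Set Implicit Arguments.
Unset Strict Implicit.
Unset Printing Implicit Defensive.

(** * Torus and step cost *)

Section TorusTopology.
Variables (R : realType) (N : nat).
Local Notation V := 'rV[R]_N.
Local Notation T := (torus R N).
Local Notation pr := (\pi_(torus R N)%qT : V -> T).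

Lemma torus_eqP (a b : V) : pr a = pr b <-> a - b \in Zlattice R N.
Proof.
have H := (@Quotient.idealrBE V (Zlattice R N) a b).
split=> [e|]; first by rewrite H; apply/eqP.
by rewrite H => /eqP.
Qed.

Lemma repr_pi (a : V) : exists2 s, s \in Zlattice R N & repr (pr a) = a + s.
Proof.
exists (repr (pr a) - a); last by rewrite addrC subrK.
by apply/torus_eqP; rewrite reprK.
Qed.

Lemma pi_periodic (a s : V) : s \in Zlattice R N -> pr (a + s) = pr a.
Proof. by move=> sZ; apply/torus_eqP; rewrite addrC addKr. Qed.

(** The saturation of [A] is the union of its lattice translates. *)
Lemma pi_open (A : set V) : open A -> open (pr @` A).
Proof.
move=> oA; rewrite /open /= /quotient_open.
have -> : pr @^-1` (pr @` A) =
   \bigcup_(s in [set s : V | s \in Zlattice R N]) ((fun a => a + s) @^-1` A).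
  apply/seteqP; split=> a /=.
    move=> [b Ab /torus_eqP ba]; exists (b - a) => //=.
    by rewrite addrC subrK.
  by move=> [s sZ /= Aas]; exists (a + s) => //; rewrite pi_periodic.
apply: bigcup_open => s _.
apply: open_comp oA => a _.
by apply: (@cvgD _ _ _ (nbhs a)); [exact: cvg_id | exact: cvg_cst].
Qed.

Lemma nbhs_pi (a : V) (A : set V) : nbhs a A -> nbhs (pr a) (pr @` A).
Proof.
rewrite {1}nbhsE => -[B [oB Ba] BA]; rewrite nbhsE.
exists (pr @` B); last exact: image_subset.
by split; [exact: pi_open | exists a].
Qed.

(** The product of a quotient map with an identity need not be a quotient map; here it works because
    [pr] is open. *)
Lemma continuous_torus_lift (E Y : topologicalType) (f : T * E -> Y) :
  continuous (fun z : V * E => f (pr z.1, z.2)) -> continuous f.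
Proof.
move=> cf [x e]; rewrite -[x]reprK => A /(cf (repr x, e)) [[B C] /= [nB nC] BC].
exists (pr @` B, C) => /=; first by split => //; exact: nbhs_pi.
by move=> [y e'] /= [[b Bb <-] Ce']; exact: (BC (b, e')).
Qed.

Lemma translate_pi (a w : V) : translate (pr a) w = pr (a + w).
Proof.
by have [s sZ e] := repr_pi a; rewrite /translate e addrAC; exact: pi_periodic.
Qed.

Lemma translate_continuous : continuous (fun z : T * V => translate z.1 z.2).
Proof.
apply: continuous_torus_lift => z /=.
under eq_fun do rewrite translate_pi.
apply: continuous_comp; last exact: pi_continuous.
by apply: cvgD; [exact: cvg_fst | exact: cvg_snd].
Qed.

Lemma cube_representative (a : V) :
  exists2 s, s \in Zlattice R N & `|a - s| <= 1.
Proof.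
exists (\row_i (Num.floor (a 0 i))%:~R).
  by apply/mxOverP => i j; rewrite mxE intr_int.
rewrite [leLHS]/Num.norm/= mx_normrE; apply/bigmax_leP; split => // -[i j] _ /=.
rewrite !mxE !ord1 ger0_norm ?subr_ge0 ?floor_le//.
by have /andP[_ /ltW] := floor_itv (a 0 j); rewrite intrD lerBlDl.
Qed.

Lemma ball_compact (r : R) : compact [set v : V | `|v| <= r].
Proof.
apply: bounded_closed_compact.
  exists r; split; first exact: num_real.
  by move=> x /ltW rx v /= vr; exact: le_trans rx.
have -> : [set v : V | `|v| <= r] = (fun v : V => `|v|) @^-1` [set x | x <= r] by [].
by apply: preimage_closed => [v _|]; [exact: norm_continuous | exact: closed_le].
Qed.

Lemma torus_compact : compact [set: T].
Proof.
have -> : [set: T] = pr @` [set v : V | `|v| <= 1].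
  apply/seteqP; split=> // x _; have [s sZ le1] := cube_representative (repr x).
  exists (repr x - s) => //=.
  by rewrite pi_periodic ?rpredN// reprK.
apply: continuous_compact (@ball_compact 1).
by apply: continuous_subspaceT; exact: pi_continuous.
Qed.

End TorusTopology.

(** * Uniform continuity and coercivity of the Lagrangian and of the step cost *)

Section Lagrangian.
Variables (R : realType) (N : nat).
Local Notation V := 'rV[R]_N.
Local Notation T := (torus R N).
Local Notation pr := (\pi_(torus R N)%qT : V -> T).
Variable L : V * V -> R.

Lemma norm_le_enorm (v : V) : `|v| <= enorm v.
Proof.
rewrite [leLHS]/Num.norm/= mx_normrE; apply/bigmax_leP; split.
  exact: sqrtr_ge0.
move=> -[i j] _ /=; rewrite ord1 -sqrtr_sqr ler_wsqrtr// (bigD1 j)//= lerDl.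
by apply: sumr_ge0 => k _; exact: sqr_ge0.
Qed.

Hypothesis cL : continuous L.
Hypothesis perL : periodic_in_x L.
Hypothesis supL : superlinear L.

Lemma superlinear_norm (A : R) : 0 <= A ->
  exists2 r, 0 <= r & forall x v : V, r < `|v| -> A * `|v| < L (x, v).
Proof.
move=> A0; have [r rP] := supL A; exists (Num.max r 0).
  by rewrite le_max lexx orbT.
move=> x v; rewrite gt_max => /andP[rv v0].
have ve := norm_le_enorm v.
have e0 : 0 < enorm v by exact: lt_le_trans ve.
have := rP x v (lt_le_trans rv ve); rewrite ltr_pdivlMr//.
by apply: le_lt_trans; rewrite ler_wpM2l.
Qed.

Lemma compact_strip (M : R) :
  compact ([set x : V | `|x| <= 1] `*` [set v : V | `|v| <= M]).
Proof. by apply: compact_setX; exact: ball_compact. Qed.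

Lemma L_unif_continuous (M e : R) : 0 < e -> exists2 d, 0 < d &
  forall x x' v v' : V, `|v| <= M -> `|x - x'| < d -> `|v - v'| < d ->
    `|L (x, v) - L (x', v')| < e.
Proof.
move=> e0.
(* The near-covering form of compactness merges the local moduli of continuity into one [d] for the
   whole strip. *)
have /compact_near_coveringP := @compact_strip M.
move=> /(_ R (0^'+) (fun d z => forall z' : V * V, `|z.1 - z'.1| < d ->
   `|z.2 - z'.2| < d -> `|L z - L z'| < e) _) [].
  move=> z _.
  have e20 : 0 < e / 2 by rewrite divr_gt0.
  have /cvgrPdist_lt/(_ _ e20)/nbhs_ballP[d /= d0 dP] := @cL z.
  have d20 : 0 < d / 2 by rewrite divr_gt0.
  exists (ball z (d / 2), [set y | y < d / 2]) => /=.
    split; first exact: nbhsx_ballx.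
    exact: nbhs_right_lt.
  move=> [y s] /= [[zy1 zy2] sd] z' z1 z2.
  have h1 : `|L z - L y| < e / 2.
    apply: dP; split; [move: zy1 | move: zy2]; apply: le_ball; lra.
  have h2 : `|L z - L z'| < e / 2.
    move: zy1 zy2; rewrite -!ball_normE /= => zy1 zy2.
    apply: dP; split; rewrite -ball_normE /=.
      have := ler_distD y.1 z.1 z'.1; lra.
    have := ler_distD y.2 z.2 z'.2; lra.
  by rewrite (splitr e) (le_lt_trans (ler_distD (L z) _ _))// ltrD// distrC.
move=> d /= d0 dP.
exists (d / 2); first by rewrite divr_gt0.
move=> x x' v v' vM xx vv.
(* One lattice shift is applied to both points. It brings [x] into the cube; [x'] may leave it,
   which is why [z'] ranges over the whole space above. *)
have [s sZ s1] := cube_representative x.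
rewrite -(@perL x v (- s)) ?rpredN// -(@perL x' v' (- s)) ?rpredN//.
apply: (dP (d / 2)) => //=.
- by rewrite /= sub0r normrN gtr0_norm ?ltr_pdivrMr//; lra.
- by rewrite divr_gt0.
- by rewrite opprB addrA subrK.
Qed.

Lemma L_bounded_below : exists B, forall z, B <= L z.
Proof.
have [r r0 rP] := superlinear_norm (lexx 0).
have : compact (L @` ([set x : V | `|x| <= 1] `*` [set v : V | `|v| <= r])).
  apply: continuous_compact (@compact_strip r); exact: continuous_subspaceT.
move=> /compact_bounded[B [_ /(_ (Num.max B 0 + 1))]].
rewrite ltr_pwDr ?le_max ?lexx// => /(_ isT) BP.
exists (- (Num.max B 0 + 1)) => -[x v].
have B0 : 0 <= Num.max B 0 by rewrite le_max lexx orbT.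
have [vr|/(rP x)] := leP `|v| r; last by rewrite mul0r; lra.
have [s sZ s1] := cube_representative x.
rewrite -(@perL x v (- s)) ?rpredN//.
have : `|L (x - s, v)| <= Num.max B 0 + 1 by apply: BP; exists (x - s, v).
by rewrite ler_norml => /andP[].
Qed.

Variables h H : R.
Hypothesis h0 : 0 < h.

Definition step (a b : V) : R := h * (L (a, h^-1 *: (b - a)) - H).

Lemma step_translate (a b s : V) : s \in Zlattice R N ->
  step (a + s) (b + s) = step a b.
Proof. by move=> sZ; rewrite /step perL// opprD addrACA subrr addr0. Qed.

(** Beyond the radius [r], superlinearity with slope 1 bounds the velocity by the value of [L],
    which is at most [S / h + H]. *)
Lemma step_coercive (S : R) :
  exists M, forall a b, step a b <= S -> `|b - a| <= M.
Proof.
have [r r0 rP] := superlinear_norm ler01.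
exists (h * Num.max r (S / h + H)) => a b abS.
have -> : b - a = h *: (h^-1 *: (b - a)) by rewrite scalerA divff ?gt_eqF// scale1r.
rewrite normrZ gtr0_norm// ler_pM2l// le_max.
have [//|/(rP a)/=] := leP `|h^-1 *: (b - a)| r.
rewrite mul1r => /ltW /le_trans; apply.
by rewrite -lerBlDr ler_pdivlMr// mulrC.
Qed.

Lemma step_unif_continuous (M e : R) : 0 < e -> exists2 d, 0 < d &
  forall a a' b b' : V, `|b - a| <= M -> `|a - a'| < d -> `|b - b'| < d ->
    `|step a b - step a' b'| < e.
Proof.
move=> e0; have eh0 : 0 < e / h by rewrite divr_gt0.
have [d d0 dP] := L_unif_continuous (h^-1 * M) eh0.
(* The velocity changes by at most [h^-1] times the sum of the two displacements, hence the factor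
   [h / 2]. *)
exists (Num.min d (h * d / 2)); first by rewrite lt_min d0 !mulr_gt0.
move=> a a' b b' abM; rewrite !lt_min => /andP[aa1 aa2] /andP[bb1 bb2].
rewrite /step -mulrBr opprB addrA subrK normrM gtr0_norm// mulrC -ltr_pdivlMr//.
apply: dP => //.
  by rewrite normrZ gtr0_norm ?invr_gt0// ler_pM2l ?invr_gt0.
rewrite -scalerBr normrZ gtr0_norm ?invr_gt0// ltr_pdivrMl//.
have -> : b - a - (b' - a') = (b - b') - (a - a').
  by rewrite !opprB (addrC a' (- b')) addrACA (addrC (- a)).
have := ler_normB (b - b') (a - a'); lra.
Qed.

End Lagrangian.

(** * Fixed points of the Lax-Oleinik operator *)

Section WeakKAM.
Variables (R : realType) (N : nat).
Local Notation V := 'rV[R]_N.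
Local Notation T := (torus R N).
Local Notation pr := (\pi_(torus R N)%qT : V -> T).
Variable L : V * V -> R.
Hypothesis cL : continuous L.
Hypothesis perL : periodic_in_x L.
Hypothesis supL : superlinear L.
Variables h H : R.
Hypothesis h0 : 0 < h.
Local Notation step := (step L h H).

Definition subaction (u : T -> R) := forall a b, u (pr a) <= step a b + u (pr b).

(** Together with [subaction] this is the fixed point equation of the Lax-Oleinik operator, with the
    infimum expressed by approximate minimizers. *)
Definition almost_attained (u : T -> R) := forall a e, 0 < e ->
  exists b, step a b + u (pr b) < u (pr a) + e.

Lemma step_continuous a : continuous (step a).
Proof.
move=> b; apply/(cvgrPdist_lt (FF := nbhs_filter b)) => e e0.
have [d d0 dP] := step_unif_continuous cL perL H h0 `|b - a| e0.
apply/nbhs_ballP; exists d => //= b'; rewrite -ball_normE /= => bb'.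
by apply: dP => //; rewrite subrr normr0.
Qed.

(** Near [a0], almost optimal steps have bounded length, so [u] inherits the uniform continuity of
    [step] on such steps. *)
Lemma continuous_fixpoint (B : R) (u : T -> R) : (forall x, B <= u x) ->
  subaction u -> almost_attained u -> continuous u.
Proof.
move=> Bu sub att; apply/quotient_continuous => a0.
apply/(cvgrPdist_lt (FF := nbhs_filter a0)) => e e0 /=.
have e20 : 0 < e / 2 by rewrite divr_gt0.
have [d1 d10 d1P] := step_unif_continuous cL perL H h0 0 ltr01.
(* This bounds the cost of an almost optimal step from any [a] near [a0]: [u (pr a)] is at most
   [step a a0 + u (pr a0)], and [u] is at least [B] at the end of the step. *)
have [M MP] := step_coercive supL H h0 (step a0 a0 + 1 + u (pr a0) + e / 2 - B).
have [d2 d20 d2P] := step_unif_continuous cL perL H h0 M e20.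
(* The estimate is one-sided but uniform for [a] near [a0], so it can be applied with [a0] in either
   place. *)
have key a a' : `|a0 - a| < d1 -> `|a - a'| < d2 -> u (pr a') < u (pr a) + e.
  move=> a0a aa'.
  have : `|step a0 a0 - step a a0| < 1.
    by apply: d1P => //; rewrite subrr normr0.
  rewrite ltr_norml => /andP[h1 _].
  have h2 := sub a a0.
  have [b bP] := att a _ e20.
  have abM : `|b - a| <= M by apply: MP; have := Bu (pr b); lra.
  have : `|step a b - step a' b| < e / 2.
    by apply: d2P => //; rewrite subrr normr0.
  rewrite ltr_norml => /andP[h3 _].
  have h4 := sub a' b.
  lra.
apply/nbhs_ballP; exists (Num.min d1 d2) => /=; first by rewrite lt_min d10.
move=> a; rewrite -ball_normE /= lt_min => /andP[a1 a2].
have k1 : u (pr a) < u (pr a0) + e by apply: key => //; rewrite subrr normr0.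
have k2 : u (pr a0) < u (pr a) + e by apply: key => //; rewrite distrC.
by rewrite ltr_norml; apply/andP; split; lra.
Qed.

Definition action (k : nat) (p : nat -> V) := \sum_(i < k) step (p i) (p i.+1).

Lemma action_path (q : nat -> V) (u : T -> R) m n : subaction u ->
  u (pr (q m)) <= action n (fun i => q (m + i)%N) + u (pr (q (m + n)%N)).
Proof.
move=> sub; elim: n => [|n IH]; first by rewrite /action big_ord0 addn0 add0r.
rewrite /action big_ord_recr /= addnS -addrA; apply: le_trans IH _.
by rewrite lerD2l; exact: sub.
Qed.

Lemma torus_continuous_bounded (u : T -> R) : continuous u ->
  exists B, forall x, `|u x| <= B.
Proof.
move=> cu; have : compact (u @` [set: T]).
  by apply: continuous_compact; [exact: continuous_subspaceT | exact: torus_compact].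
move=> /compact_bounded[B [_ /(_ (B + 1))]].
rewrite ltrDl ltr01 => /(_ isT) BP.
by exists (B + 1) => x; apply: BP; exists x.
Qed.

Lemma action_translate k p s : s \in Zlattice R N ->
  action k (fun i => p i + s) = action k p.
Proof. by move=> sZ; apply: eq_bigr => i _; exact: step_translate. Qed.

(** * The action potential of a non-wandering point *)

Section Potential.
Hypothesis cycle_ge0 : forall k (p : nat -> V),
  pr (p 0%N) = pr (p k.+1) -> 0 <= action k.+1 p.
Variable z : V.
Hypothesis z_nonwandering : forall e, 0 < e -> exists k (p : nat -> V),
  [/\ pr (p 0%N) = pr z, pr (p k.+1) = pr z & action k.+1 p < e].

(** At least one step is required, so that every path has a first step to split off. *)
Definition actions_to (a : V) : set R := [set r | exists k (p : nat -> V),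
  [/\ p 0%N = a, pr (p k.+1) = pr z & r = action k.+1 p]].

Definition potential (a : V) : R := inf (actions_to a).

Lemma actions_to_translate a s : s \in Zlattice R N ->
  actions_to a `<=` actions_to (a + s).
Proof.
move=> sZ r [k [p [p0 pk ->]]]; exists k, (fun i => p i + s).
by rewrite p0 pi_periodic// action_translate.
Qed.

Lemma potential_periodic a b : pr a = pr b -> potential a = potential b.
Proof.
move=> /torus_eqP abZ; congr inf; apply/seteqP; split.
  have -> : b = a - (a - b) by rewrite subKr.
  by apply: actions_to_translate; rewrite rpredN.
have -> : a = b + (a - b) by rewrite addrC subrK.
exact: actions_to_translate.
Qed.

Lemma step_actions_to a : actions_to a (step a z).
Proof.
exists 0%N, (fun i => if i == 0%N then a else z); split => //.
by rewrite /action big_ord1.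
Qed.

Lemma step_cons_actions_to a b r : actions_to b r -> actions_to a (step a b + r).
Proof.
move=> [k [p [<- pk ->]]]; exists k.+1, (fun i => if i is j.+1 then p j else a).
by split => //; rewrite [in RHS]/action big_ord_recl.
Qed.

(** A further step from [z] back to [a] closes the path into a cycle of the torus, whose action is
    nonnegative. *)
Lemma actions_to_ge a r : actions_to a r -> - step z a <= r.
Proof.
move=> [k [p [p0 pk ->]]].
have sZ : p k.+1 - z \in Zlattice R N by apply/torus_eqP.
(* The path ends at a lattice translate of [z], so the closing step goes to the same translate of
   [a]. *)
pose p' i := if (i <= k.+1)%N then p i else a + (p k.+1 - z).
have : 0 <= action k.+2 p'.
  by apply: cycle_ge0; rewrite /p' /= ltnn p0 pi_periodic.
rewrite /action big_ord_recr /= {3 4}/p' leqnn ltnn.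
have -> : step (p k.+1) (a + (p k.+1 - z)) = step z a.
  by rewrite -(step_translate perL h H z a sZ) (addrC z) subrK.
rewrite (_ : \sum_(i < _) _ = action k.+1 p); last first.
  by apply: eq_bigr => i _; rewrite /p' ltnW// ltn_ord.
by rewrite /action; lra.
Qed.

Lemma has_inf_actions a : has_inf (actions_to a).
Proof.
split; first by exists (step a z); exact: step_actions_to.
by exists (- step z a) => r; exact: actions_to_ge.
Qed.

Lemma potential_le a r : actions_to a r -> potential a <= r.
Proof. by apply: ge_inf; have [] := has_inf_actions a. Qed.

Lemma potential_subaction a b : potential a <= step a b + potential b.
Proof.
rewrite -lerBlDl; apply: lb_le_inf; first by have [] := has_inf_actions b.
move=> r /(step_cons_actions_to a) /potential_le; lra.
Qed.

Lemma potential_z : potential z <= 0.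
Proof.
apply/ler_addgt0Pr => e e0; rewrite add0r.
have [k [p [p0 pk pe]]] := z_nonwandering e0.
rewrite -(potential_periodic p0); apply: le_trans (ltW pe).
by apply: potential_le; exists k, p.
Qed.

(** The first step of an almost optimal path is almost optimal. *)
Lemma potential_attained a e : 0 < e ->
  exists b, step a b + potential b < potential a + e.
Proof.
move=> e0; have [r [k [p [p0 pk ->]]] re] := inf_adherent e0 (has_inf_actions a).
exists (p 1%N); apply: le_lt_trans re.
rewrite /action big_ord_recl /= p0 lerD2l.
(* After a one-step path nothing remains; the bound then comes from [potential_z], that is, from [z]
   being non-wandering. *)
case: k pk => [|k] pk.
  by rewrite big_ord0 (potential_periodic pk) potential_z.
by apply: potential_le; exists k, (fun i => p i.+1).
Qed.

(** By periodicity [a] may be taken in a compact cube, on which the lower bound [- step z a] is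
    bounded. *)
Lemma potential_ge : exists B, forall a, B <= potential a.
Proof.
have : compact (step z @` [set v : V | `|v| <= 1]).
  apply: continuous_compact (@ball_compact _ _ 1).
  by apply: continuous_subspaceT; exact: step_continuous.
move=> /compact_bounded[B [_ /(_ (B + 1))]].
rewrite ltrDl ltr01 => /(_ isT) BP.
exists (- (B + 1)) => a; have [s sZ s1] := cube_representative a.
have -> : potential a = potential (a - s).
  by apply: potential_periodic; rewrite pi_periodic// rpredN.
have : `|step z (a - s)| <= B + 1 by apply: BP; exists (a - s).
rewrite ler_norml => /andP[_ h1].
apply: lb_le_inf; first by have [] := has_inf_actions (a - s).
by move=> r /actions_to_ge; lra.
Qed.

Lemma exists_fixpoint : exists u : T -> R,
  [/\ continuous u, subaction u & almost_attained u].
Proof.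
pose u (x : T) := potential (repr x).
have uE a : u (pr a) = potential a by apply: potential_periodic; rewrite reprK.
have sub : subaction u by move=> a b; rewrite !uE; exact: potential_subaction.
have att : almost_attained u.
  by move=> a e /(potential_attained a)[b]; exists b; rewrite !uE.
exists u; split => //; have [B BP] := potential_ge.
exact: (continuous_fixpoint (fun x => BP (repr x)) sub att).
Qed.

End Potential.

End WeakKAM.

(** * Almost calibrated orbits and comparison of subactions *)

Section Comparison.
Variables (R : realType) (N : nat).
Local Notation V := 'rV[R]_N.
Local Notation T := (torus R N).
Local Notation pr := (\pi_(torus R N)%qT : V -> T).
Variable L : V * V -> R.
Hypothesis cL : continuous L.
Hypothesis perL : periodic_in_x L.
Hypothesis supL : superlinear L.
Variables h H : R.
Hypothesis h0 : 0 < h.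
Local Notation step := (step L h H).
Local Notation action := (action L h H).
Local Notation subaction := (subaction L h H).
Local Notation almost_attained := (almost_attained L h H).

(* The errors telescope, so the actions along the orbit are controlled without
   exact minimizers. *)
Lemma almost_calibrated_orbit (w : T -> R) (x : T) (e : nat -> R) :
  almost_attained w -> (forall i, e i.+1 < e i) ->
  exists q : nat -> V, pr (q 0%N) = x /\
    forall i, step (q i) (q i.+1) + w (pr (q i.+1)) < w (pr (q i)) + (e i - e i.+1).
Proof.
move=> att eS.
have /choice[f fP] : forall ia : nat * V, exists b, step ia.2 b + w (pr b) <
    w (pr ia.2) + (e ia.1 - e ia.1.+1).
  by move=> [i a]; apply: att; rewrite subr_gt0.
pose fix q i := if i is j.+1 then f (j, q j) else repr x.
by exists q; split; [rewrite /= reprK | move=> i; exact: (fP (i, q i))].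
Qed.

Lemma cluster_frequently (x : nat -> T) : exists z : T, forall (U : set T) m, nbhs z U ->
  exists2 n, (m <= n)%N & U (x n).
Proof.
have [z [_ zP]] := @torus_compact R N (x @ \oo) _ filterT.
exists z => U m zU.
have [|_ [[n mn <-] Ux]] := zP (x @` [set n | (m <= n)%N]) U _ zU.
  by exists m => //= n mn; exists n.
by exists n.
Qed.

(** The condition of [nonwandering], with an arbitrary constant [H] in place of [Hbar]. *)
Definition nonwandering_pt (z : T) := forall e, 0 < e -> exists k s (p : nat -> V),
  [/\ (1 <= k)%N, s \in Zlattice R N, p 0%N = repr z + s, p k = repr z
    & `|action k p| < e].

Section Orbit.
Variables (w : T -> R) (e : nat -> R).
Hypothesis cw : continuous w.
Hypothesis sub : subaction w.
Hypothesis e_ge0 : forall i, 0 <= e i.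
Hypothesis e_le : forall i, e i <= e 0%N.
Hypothesis e_small : forall d, 0 < d -> exists m0, forall m, (m0 <= m)%N -> e m < d.
Variable q : nat -> V.
Hypothesis qP : forall i,
  step (q i) (q i.+1) + w (pr (q i.+1)) < w (pr (q i)) + (e i - e i.+1).

Lemma orbit_action m n :
  action n (fun i => q (m + i)%N) <=
    w (pr (q m)) - w (pr (q (m + n)%N)) + (e m - e (m + n)%N).
Proof.
elim: n => [|n IH]; first by rewrite /action big_ord0 addn0 !subrr addr0.
rewrite /action big_ord_recr /= addnS.
have := qP (m + n)%N; rewrite -ltrBrDr => /ltW /(lerD IH) /le_trans; apply; lra.
Qed.

Lemma orbit_step_bounded : exists M, forall i, `|q i.+1 - q i| <= M.
Proof.
have [B BP] := torus_continuous_bounded cw.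
have [M MP] := step_coercive supL H h0 (B + B + e 0%N).
exists M => i; apply: MP; have := qP i.
have := BP (pr (q i)); have := BP (pr (q i.+1)); rewrite !ler_norml.
move=> /andP[b1 b2] /andP[b3 b4].
have := e_ge0 i.+1; have := e_le i; lra.
Qed.

(** Between two late visits near [z], the orbit has action close to a difference of two values of
    [w] near [z], hence close to 0. Moving the two ends of this piece onto lifts of [z] gives the
    required path. *)
Lemma cluster_nonwandering z :
  (forall (U : set T) m, nbhs z U -> exists2 n, (m <= n)%N & U (pr (q n))) ->
  nonwandering_pt z.
Proof.
move=> zP eps eps0.
(* Five errors add up: the two altered steps, the two values of [w], and [e m]. *)
have eps5 : 0 < eps / 5 by rewrite divr_gt0.
have [M MP] := orbit_step_bounded.
have [d d0 dP] := step_unif_continuous cL perL H h0 M eps5.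
pose U := pr @` ball (repr z) d `&` [set y | `|w z - w y| < eps / 5].
have zU : nbhs z U.
  apply: filterI.
    by rewrite -{1}[z]reprK; apply: nbhs_pi; exact: nbhsx_ballx.
  by have /(cvgrPdist_lt (FF := nbhs_filter z))/(_ _ eps5) := @cw z.
have [m0 m0P] := e_small eps5.
have [m mm0 [[a za am] wm]] := zP _ m0 zU.
(* At least two steps lie between the visits, so the altered first and last steps are distinct. *)
have [n mn [[a' za' an] wn]] := zP _ m.+2 zU.
have s1Z : q m - a \in Zlattice R N by apply/torus_eqP.
have s2Z : q n - a' \in Zlattice R N by apply/torus_eqP.
have [k nE] : exists k, n = (m + k.+2)%N.
  by exists (n - m.+2)%N; rewrite !addnS -addSn -addSn subnKC.
move: an wn s2Z; rewrite nE.
have subBB (b b' s : V) : b - s - (b' - s) = b - b' by rewrite opprB addrA subrK.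
move=> an wn; set s2 := q _ - a' => s2Z; set s1 := q m - a in s1Z.
(* Shifting by [s2] brings the final visit next to [repr z]; the initial one then lies next to
   [repr z + (s1 - s2)]. *)
pose p i := if i == 0%N then repr z + (s1 - s2)
  else if i == k.+2 then repr z else q (m + i)%N - s2.
exists k.+2, (s1 - s2), p; split => //; first by rewrite rpredB.
  by rewrite /p eqxx.
pose q' i := q (m + i)%N.
have shift b b' : step (b - s2) (b' - s2) = step b b'.
  by apply: step_translate => //; rewrite rpredN.
have pE i : (i < k.+1)%N -> p i.+1 = q' i.+1 - s2.
  by move=> ik; rewrite /p /= eqSS ltn_eqF.
have pk : p k.+2 = repr z by rewrite /p eqxx.
have mid : \sum_(i < k) step (p i.+1) (p i.+2) = \sum_(i < k) step (q' i.+1) (q' i.+2).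
  apply: eq_bigr => i _; have ik := ltn_ord i.
  by rewrite !pE ?shift// ltnS// ltnW.
have first : `|step (q' 0%N) (q' 1%N) - step (p 0%N) (p 1%N)| < eps / 5.
  rewrite pE// -shift; apply: dP.
  - by rewrite subBB /q' addn1 addn0 MP.
  - rewrite /p /= /q' addn0 addrA subBB opprD addrCA /s1 subKr addrC distrC.
    by move: za; rewrite -ball_normE.
  - by rewrite subrr normr0.
have last : `|step (q' k.+1) (q' k.+2) - step (p k.+1) (p k.+2)| < eps / 5.
  rewrite pE// pk -shift; apply: dP.
  - by rewrite subBB /q' addnS MP.
  - by rewrite subrr normr0.
  - by rewrite /q' /s2 subKr distrC; move: za'; rewrite -ball_normE.
have decomp (r : nat -> V) : action k.+2 r =
    step (r 0%N) (r 1%N) + \sum_(i < k) step (r i.+1) (r i.+2) +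
    step (r k.+1) (r k.+2).
  by rewrite /action big_ord_recl big_ord_recr /= addrA.
have up := orbit_action m k.+2; have low := action_path q m k.+2 sub.
move: up low; rewrite -/(q') !decomp mid.
have := m0P _ mm0; have := e_ge0 (m + k.+2)%N.
move: first last wm wn; rewrite /= !ltr_norml.
move=> /andP[f1 f2] /andP[l1 l2] /andP[wm1 wm2] /andP[wn1 wn2] e1 e2 up low.
apply/andP; split; lra.
Qed.

End Orbit.

Lemma subaction_comparison (w1 w2 : T -> R) (c : R) :
  continuous w1 -> subaction w1 ->
  continuous w2 -> subaction w2 -> almost_attained w2 ->
  (forall z, nonwandering_pt z -> w1 z - w2 z = c) ->
  forall x, w1 x - w2 x <= c.
Proof.
move=> cw1 s1 cw2 s2 a2 eqc x; apply/ler_addgt0Pr => e e0.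
have e20 : 0 < e / 2 by rewrite divr_gt0.
(* The telescoping errors cost at most [ee 0 = e / 2]; the other half of [e] pays for the distance
   to the cluster point. *)
pose ee (i : nat) := e / 2 / i.+1%:R.
have eeS i : ee i.+1 < ee i.
  by rewrite ltr_pM2l// ltf_pV2 ?posrE// ltr_nat.
have ee_ge0 i : 0 <= ee i by rewrite divr_ge0// ltW.
have ee_le i : ee i <= ee 0%N.
  by rewrite /ee divr1 ler_pdivrMr// ler_peMr ?ler1n// ltW.
have ee_small d : 0 < d -> exists m0, forall m, (m0 <= m)%N -> ee m < d.
  move=> d0; exists (Num.truncn (d^-1 * (e / 2))) => m mm.
  rewrite ltr_pdivrMr// -ltr_pdivrMl//.
  apply: lt_le_trans (truncnS_gt _) _.
  by rewrite ler_nat ltnS.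
have [q [q0 qP]] := almost_calibrated_orbit x a2 eeS.
have [z zP] := cluster_frequently (fun i => pr (q i)).
have zc := eqc z (cluster_nonwandering cw2 s2 ee_ge0 ee_le ee_small qP zP).
have [|n _ /= wn] := zP [set y | `|(w1 z - w2 z) - (w1 y - w2 y)| < e / 2] 0%N.
  apply: (proj1 (cvgrPdist_lt (FF := nbhs_filter z) _ _)) => //.
  by apply: cvgB; [exact: cw1 | exact: cw2].
move: wn; rewrite zc -q0 ltr_norml => /andP[wn _].
have := action_path q 0 n s1; have := orbit_action qP 0 n.
have := ee_ge0 n.
have -> : ee 0%N = e / 2 by rewrite /ee divr1.
rewrite !add0n; lra.
Qed.

End Comparison.

(** * Mather measures *)

Section EmpiricalMeasure.
Context d (X : measurableType d) (R : realType).

Lemma exists_empirical_measure (z : nat -> X) (k : nat) :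
  exists nu : probability X R, forall f : X -> R, measurable_fun [set: X] f ->
    (\int[nu]_x (f x)%:E = (k.+1%:R^-1 * \sum_(i < k.+1) f (z i))%:E)%E.
Proof.
have r0 : 0 <= k.+1%:R^-1 :> R by rewrite invr_ge0.
pose m : {measure set X -> \bar R} := mscale (NngNum r0) (msum (fun i => \d_(z i)) k.+1).
have m1 : m setT = 1%E.
  rewrite /m /= /mscale /= /msum /=.
  under eq_bigr do rewrite diracT.
  by rewrite sumEFin sumr_const card_ord -EFinM mulVf.
pose nu : probability X R :=
  HB.pack (m : set X -> \bar R) m (Measure_isProbability.Build _ _ _ m m1).
exists nu => f mf.
(* Integrals against scaled measures and sums are computed for nonnegative functions first, then
   applied to the positive and negative parts of [f]. *)
have int_ge0 (g : X -> \bar R) : measurable_fun [set: X] g -> (forall x, 0 <= g x)%E ->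
    (\int[nu]_x g x = k.+1%:R^-1%:E * \sum_(i < k.+1) g (z i))%E.
  move=> mg g0; rewrite [LHS](_ : _ = \int[m]_x g x)%E //.
  rewrite ge0_integral_mscale// ge0_integral_measure_sum//=.
  by congr (_ * _)%E; apply: eq_bigr => i _; rewrite integral_dirac//= diracT mul1e.
rewrite integralE !int_ge0//; last 2 first.
- by apply/measurable_funeneg/measurable_EFinP.
- by apply/measurable_funepos/measurable_EFinP.
under eq_bigr do rewrite funeposE -EFin_max.
under [X in (_ - _ * X)%E]eq_bigr do rewrite funenegE -EFinN -EFin_max.
rewrite !sumEFin -!EFinM -EFinB -mulrBr -sumrB; congr (_ * _)%:E.
apply: eq_bigr => i _.
by rewrite !maxEle; case: leP => h1; case: leP => h2; lra.
Qed.

End EmpiricalMeasure.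

(** * Probability measures given by a density *)

Section Density.
Context d (X : measurableType d) (R : realType).
Variables (mu : probability X R) (rho : X -> R).
Hypothesis mrho : measurable_fun [set: X] rho.
Hypothesis rho_ge0 : forall x, 0 <= rho x.
Hypothesis rho1 : (\int[mu]_x (rho x)%:E = 1)%E.

Lemma exists_density_measure : exists nu : probability X R,
  (forall A, measurable A -> nu A = \int[mu]_(x in A) (rho x)%:E)%E /\
  (forall f : X -> R, nu.-integrable setT (EFin \o f) ->
     \int[nu]_x (f x)%:E = \int[mu]_x (f x * rho x)%:E)%E.
Proof.
pose m0 A := (\int[mu]_(x in A) (rho x)%:E)%E.
have m00 : m0 set0 = 0%E by rewrite /m0 integral_set0.
have m0_ge0 A : (0 <= m0 A)%E by apply: integral_ge0 => x _; rewrite lee_fin.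
have mErho : measurable_fun [set: X] (fun x => (rho x)%:E) by apply/measurable_EFinP.
have m0_sigma : semi_sigma_additive m0.
  by apply: semi_sigma_additive_nng_induced => // x; rewrite lee_fin.
pose m : {measure set X -> \bar R} :=
  HB.pack m0 (isMeasure.Build _ _ _ m0 m00 m0_ge0 m0_sigma).
pose nu : probability X R :=
  HB.pack m0 m (Measure_isProbability.Build _ _ _ m rho1).
have nuE A : nu A = (\int[mu]_(x in A) (rho x)%:E)%E by [].
exists nu; split=> // f intf.
have numu : nu `<< mu.
  apply/null_content_dominatesP => A mA muA; rewrite nuE.
  apply: null_set_integral => //.
  exact: measurable_funTS.
(* The change of variables uses the Radon-Nikodym derivative, which agrees with [rho] almost
   everywhere because both have the same integrals over measurable sets. *)
rewrite -(Radon_Nikodym_change_of_variables numu)//.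
have intrho : mu.-integrable setT (EFin \o rho).
  apply/integrableP; split => //.
  under eq_integral do rewrite gee0_abs ?lee_fin//.
  by rewrite rho1 ltry.
apply: ae_eq_integral => //.
- apply: emeasurable_funM; first exact: measurable_int intf.
  by [].
- apply/measurable_EFinP; apply: measurable_funM => //.
  by apply/measurable_EFinP; exact: measurable_int intf.
- under [X in ae_eq _ _ _ X]eq_fun do rewrite EFinM.
  apply: ae_eqe_mul2l.
  apply: integral_ae_eq => //; first exact: Radon_Nikodym_integrable.
  move=> E _ mE.
  by rewrite -Radon_Nikodym_integral.
Qed.

End Density.

(** * Supports, holonomic measures and the minimal action *)

Section PhaseSpace.
Variables (R : realType) (N : nat).
Local Notation V := 'rV[R]_N.
Local Notation T := (torus R N).
Local Notation pr := (\pi_(torus R N)%qT : V -> T).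
Local Notation X := (phase R N).

Lemma open_phase_measurable (U : set (T * V)) : open U -> measurable (U : set X).
Proof. exact: sub_sigma_algebra. Qed.

Lemma continuous_phase_measurable (f : T * V -> R) : continuous f ->
  measurable_fun [set: X] f.
Proof.
move=> /continuousP cf; apply: (measurability _ (RGenOpens.measurableE R)).
move=> _ [_ [a [b ->] <-]]; rewrite setTI; apply: open_phase_measurable.
exact/cf/interval_open.
Qed.

Lemma continuous_phase_integrable (nu : probability X R) (f : T * V -> R) (B : R) :
  continuous f -> (forall z, `|f z| <= B) -> nu.-integrable [set: X] (EFin \o f).
Proof.
move=> cf fB; apply: measurable_bounded_integrable => //.
- by rewrite -ge0_fin_numE// fin_num_measure.
- exact: continuous_phase_measurable.
- exists B; split; first exact: num_real.
  by move=> x Bx z _; apply: le_trans (fB z) (ltW Bx).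
Qed.

Lemma msupport_nonempty (mu : probability X R) : msupport mu !=set0.
Proof.
pose K n : set (T * V) := [set: T] `*` [set v | `|v| <= n%:R].
(* The compact sets [K n] exhaust the phase space, so they cannot all be negligible. *)
have [n Kn] : exists n, ~ mu.-negligible (K n : set X).
  apply/not_existsP => Kneg; have : mu.-negligible (\bigcup_n (K n : set X)).
    by apply: negligible_bigcup => n; apply: contrapT; exact: Kneg.
  have -> : \bigcup_n (K n : set X) = [set: X].
    apply/seteqP; split => // z _; exists (Num.truncn `|z.2|).+1 => //.
    by split => //=; exact/ltW/truncnS_gt.
  move=> muT; have : mu [set: X] = 0%E by apply/negligibleP.
  by rewrite probability_setT => /eqP; rewrite onee_eq0.
(* A cluster point of the sets of full measure in K n lies in the support. *)
pose F : set_system (T * V) := [set A | mu.-negligible ((K n `\` A) : set X)].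
have FF : ProperFilter F.
  split; first by rewrite /F /= setD0.
  split.
  - by rewrite /F /= setDT; exact: negligible_set0.
  - by move=> A B FA FB; rewrite /F /= setDIr; exact: negligibleU.
  - by move=> A B AB; apply: negligibleS; exact: setDS.
have cK : compact (K n) by apply: compact_setX; [exact: torus_compact | exact: ball_compact].
have [|z [_ clz]] := cK F FF; first by rewrite /F /= setDv; exact: negligible_set0.
exists z => U [oU Uz]; rewrite lt0e measure_ge0 andbT; apply/eqP => U0.
have FU : F (~` U).
  apply: (@negligibleS _ _ _ _ (U : set X)); first by move=> y [_ /contrapT].
  by apply/negligibleP => //; exact: open_phase_measurable.
by have [y []] := clz _ _ FU (open_nbhs_nbhs (conj oU Uz)).
Qed.

(** The set where [f] differs from [c] is open and null, so it misses the support. *)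
Lemma ae_msupport (mu : probability X R) (f : T * V -> R) (c : R) : continuous f ->
  {ae mu, forall z : X, f z = c} -> forall z, msupport mu z -> f z = c.
Proof.
move=> cf fc z zs; apply: contrapT => fz.
have : (0 < mu (f @^-1` (~` [set c])))%E.
  apply: zs; split=> //.
  by move/continuousP: cf; apply; exact: closed_openC (closed_eq (y := c)).
suff -> : mu (f @^-1` (~` [set c])) = 0%E by rewrite ltxx.
apply/negligibleP => //.
apply: open_phase_measurable.
by move/continuousP: cf; apply; exact: closed_openC (closed_eq (y := c)).
Qed.

Variable L : V * V -> R.
Hypothesis cL : continuous L.
Hypothesis perL : periodic_in_x L.
Hypothesis supL : superlinear L.
Variables h : R.
Hypothesis h0 : 0 < h.

Definition flow (z : T * V) : T := translate z.1 (h *: z.2).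

Lemma flow_continuous : continuous flow.
Proof.
move=> z; apply: (@continuous_comp _ _ _ (fun z : T * V => (z.1, h *: z.2))
  (fun z => translate z.1 z.2)); last exact: translate_continuous.
apply: (@cvg_pair _ _ _ (nbhs z) (nbhs z.1) (nbhs (h *: z.2))); first exact: cvg_fst.
by apply: (@cvgZl_tmp _ _ _ (nbhs z)); exact: cvg_snd.
Qed.

Lemma continuous_comp_flow (phi : T -> R) : continuous phi -> continuous (phi \o flow).
Proof. by move=> cp z; apply: continuous_comp; [exact: flow_continuous | exact: cp]. Qed.

Lemma continuous_comp_fst (phi : T -> R) : continuous phi ->
  continuous (fun z : T * V => phi z.1).
Proof. by move=> cp z; apply: continuous_comp; [exact: cvg_fst | exact: cp]. Qed.

Lemma torusL_pi a v : torusL L (pr a, v) = L (a, v).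
Proof. by have [s sZ /= e] := repr_pi a; rewrite /torusL /= e perL. Qed.

Lemma torusL_continuous : continuous (torusL L).
Proof.
apply: continuous_torus_lift.
rewrite (_ : (fun z : V * V => _) = L)//.
by apply/funext => -[a v]; exact: torusL_pi.
Qed.

Lemma torusL_bounded_below : exists B, forall z, B <= torusL L z.
Proof.
by have [B BP] := L_bounded_below cL perL supL; exists B => z; exact: BP.
Qed.

Definition coboundary (phi : T -> R) (z : T * V) : R := phi (flow z) - phi z.1.

Lemma coboundary_continuous phi : continuous phi -> continuous (coboundary phi).
Proof.
move=> cp z; apply: (@cvgB _ _ _ (nbhs z)).
  exact: continuous_comp_flow.
exact: continuous_comp_fst.
Qed.

Lemma coboundary_bounded phi : continuous phi -> exists B, forall z, `|coboundary phi z| <= B.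
Proof.
move=> /torus_continuous_bounded[B BP]; exists (B + B) => z.
by rewrite (le_trans (ler_normB _ _))// lerD.
Qed.

Lemma coboundary_integrable (nu : probability X R) phi : continuous phi ->
  nu.-integrable [set: X] (EFin \o coboundary phi).
Proof.
move=> cp; have [B BP] := coboundary_bounded cp.
exact: (continuous_phase_integrable nu (coboundary_continuous cp) BP).
Qed.

(** For the empirical measure of the positions and velocities of a cycle, the integral of a
    coboundary telescopes to 0. *)
Lemma periodic_path_measure (k : nat) (p : nat -> V) : pr (p 0%N) = pr (p k.+1) ->
  exists2 nu : probability X R, holonomic h nu &
    mean_action L nu =
      (k.+1%:R^-1 * \sum_(i < k.+1) L (p i, h^-1 *: (p i.+1 - p i)))%:E.
Proof.
move=> pk.
have [nu nuE] := @exists_empirical_measure _ X R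
  (fun i => (pr (p i), h^-1 *: (p i.+1 - p i))) k.
exists nu.
  move=> phi cp; rewrite [LHS](nuE (coboundary phi)); last first.
    apply: continuous_phase_measurable; exact: coboundary_continuous.
  rewrite (_ : \sum_(i < _) _ = 0) ?mulr0//.
  have -> : \sum_(i < k.+1) coboundary phi (pr (p i), h^-1 *: (p i.+1 - p i)) =
      \sum_(0 <= i < k.+1) (phi (pr (p i.+1)) - phi (pr (p i))).
    rewrite big_mkord; apply: eq_bigr => i _.
    rewrite /coboundary /flow /= translate_pi scalerA divff ?gt_eqF// scale1r.
    by rewrite (addrC (p i)) subrK.
  by rewrite telescope_sumr// -pk subrr.
rewrite /mean_action nuE; last by apply: continuous_phase_measurable; exact: torusL_continuous.
by under eq_bigr do rewrite torusL_pi.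
Qed.

Section MatherMeasure.
Variable mu : probability X R.
Hypothesis mu_mather : mather_measure L h mu.

(** The constant path at 0 yields a holonomic competitor of finite action, and a lower bound of [L]
    controls the negative part. *)
Lemma mean_action_fin_num : mean_action L mu \is a fin_num.
Proof.
have [B BP] := torusL_bounded_below.
have mL := continuous_phase_measurable torusL_continuous.
rewrite fin_numE; apply/andP; split; last first.
  have [nu hnu nuE] := periodic_path_measure (k := 0) (p := fun=> 0) erefl.
  have := mu_mather.2 nu hnu; rewrite nuE => /le_lt_trans.
  by move=> /(_ _ (ltry _)) ltoo; rewrite lt_eqF.
rewrite /mean_action integralE.
set q := (X in (_ - X)%E).
have q_fin : q \is a fin_num.
  rewrite ge0_fin_numE; last exact: integral_ge0.
  apply: (@le_lt_trans _ _ (\int[mu]_z (cst `|B|%:E z))%E).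
    apply: ge0_le_integral => //.
    - by apply/measurable_funeneg/measurable_EFinP.
    - move=> z _; rewrite funenegE /= ge_max !lee_fin normr_ge0 andbT.
      by rewrite -normrN; apply: le_trans (ler_norm _); rewrite lerN2.
  by rewrite integral_cst//= probability_setT mule1 ltry.
rewrite gt_eqF// (lt_le_trans (ltNyr (- fine q)))//.
rewrite EFinN (fineK q_fin) -[X in (X <= _)%E]add0e leeD2r//.
exact: integral_ge0.
Qed.

Lemma torusL_integrable : mu.-integrable [set: X] (EFin \o torusL L).
Proof.
have mL := continuous_phase_measurable torusL_continuous.
apply/integrableP; split; first exact/measurable_EFinP.
by rewrite integral_fin_num_abs//; exact: mean_action_fin_num.
Qed.

Lemma mean_action_Hbar : mean_action L mu = (Hbar L h)%:E.
Proof.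
rewrite /Hbar; suff -> : ereal_inf [set mean_action L nu | nu in holonomic h] = mean_action L mu.
  by rewrite fineK// mean_action_fin_num.
apply/eqP; rewrite eq_le; apply/andP; split.
  by apply: ereal_inf_lbound; exists mu => //; have [] := mu_mather.
by apply/ereal_infP => _ [nu hnu <-]; have [_] := mu_mather; apply.
Qed.

Local Notation H := (Hbar L h).
Local Notation step := (step L h H).
Local Notation action := (action L h H).
Local Notation subaction := (subaction L h H).

Lemma cycle_action_ge0 k (p : nat -> V) :
  pr (p 0%N) = pr (p k.+1) -> 0 <= action k.+1 p.
Proof.
move=> /periodic_path_measure[nu hnu nuE].
have := mu_mather.2 nu hnu; rewrite nuE mean_action_Hbar lee_fin.
rewrite ler_pdivlMl// => HL.
rewrite /action -mulr_sumr pmulr_rge0// sumrB sumr_const card_ord subr_ge0.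
by rewrite -mulr_natl.
Qed.

Lemma subaction_flow u z : subaction u ->
  u z.1 <= u (flow z) + h * torusL L z - h * H.
Proof.
move=> sub; case: z => x v; rewrite -[x]reprK /flow /= translate_pi.
have := sub (repr x) (repr x + h *: v).
rewrite /step addrAC subrr add0r scalerA mulVf ?gt_eqF// scale1r torusL_pi.
lra.
Qed.

Lemma holonomic_coboundary (nu : probability X R) phi : holonomic h nu -> continuous phi ->
  (\int[nu]_z (coboundary phi z)%:E = 0)%E.
Proof. by move=> hnu cphi; exact: hnu. Qed.

(** The defect [g] in the subaction inequality is nonnegative, and its integral is 0 since [mu] is
    holonomic with mean action [Hbar]. *)
Lemma ae_torusL_coboundary u : continuous u -> subaction u ->
  {ae mu, forall z : X, torusL L z = H - h^-1 * coboundary u z}.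
Proof.
move=> cu sub.
pose g z := (torusL L z - H) + h^-1 * coboundary u z.
have g_ge0 z : 0 <= g z.
  have := subaction_flow z sub.
  rewrite /g -(pmulr_rge0 _ h0) mulrDr mulrA divff ?gt_eqF// mul1r /coboundary.
  lra.
have iu := coboundary_integrable mu cu.
have iL := torusL_integrable.
have iH : mu.-integrable [set: X] (EFin \o cst H).
  exact: finite_measure_integrable_cst.
have ig0 : (\int[mu]_z (g z)%:E = 0)%E.
  rewrite /g.
  transitivity (\int[mu]_z (((torusL L z)%:E - (cst H z)%:E) + h^-1%:E * (coboundary u z)%:E))%E.
    by apply: eq_integral => z _; rewrite EFinD EFinB EFinM.
  rewrite integralD//; last 2 first.
  - exact: integrableB.
  - exact: integrableZl.
  rewrite integralB// integralZl// holonomic_coboundary// ?mule0 ?adde0; last first.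
    by have [] := mu_mather.
  have -> : (\int[mu]_z (cst H z)%:E = H%:E)%E.
    rewrite -[LHS]/(\int[mu]_z cst H%:E z)%E.
    by rewrite integral_cst//= probability_setT mule1.
  by rewrite -/(mean_action L mu) mean_action_Hbar subee.
have mg : measurable_fun [set: X] (EFin \o g).
  apply/measurable_EFinP; apply: measurable_funD.
    apply: measurable_funB => //; apply: continuous_phase_measurable; exact: torusL_continuous.
  apply: measurable_funM => //; apply: continuous_phase_measurable; exact: coboundary_continuous.
have : ae_eq mu [set: X] (EFin \o g) (cst 0%E).
  apply/ae_eq_integral_abs => //.
  by under eq_integral do rewrite /= ger0_norm//.
apply: filterS => z /(_ I) [] /eqP.
rewrite /g addr_eq0 => /eqP; lra.
Qed.

End MatherMeasure.

End PhaseSpace.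

(** * Differences of subactions on the support of a unique Mather measure *)

Section Uniqueness.
Variables (R : realType) (N : nat).
Local Notation V := 'rV[R]_N.
Local Notation T := (torus R N).
Local Notation pr := (\pi_(torus R N)%qT : V -> T).
Local Notation X := (phase R N).
Variable L : V * V -> R.
Hypothesis cL : continuous L.
Hypothesis perL : periodic_in_x L.
Hypothesis supL : superlinear L.
Variables h : R.
Hypothesis h0 : 0 < h.
Variable mu : probability X R.
Hypothesis mu_mather : mather_measure L h mu.
Local Notation H := (Hbar L h).
Local Notation step := (step L h H).
Local Notation subaction := (subaction L h H).
Local Notation coboundary := (coboundary h).

(** A converse to [ae_torusL_coboundary]: the coboundary integrates to 0, leaving the constant. *)
Lemma holonomic_ae_action (nu : probability X R) (u : T -> R) : continuous u ->
  holonomic h nu ->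
  {ae nu, forall z : X, torusL L z = H - h^-1 * coboundary u z} ->
  mean_action L nu = H%:E.
Proof.
move=> cu hnu aeL.
have iu := coboundary_integrable h nu cu.
have iH : nu.-integrable [set: X] (EFin \o cst H).
  exact: finite_measure_integrable_cst.
have iZ : nu.-integrable [set: X] (fun z => h^-1%:E * (coboundary u z)%:E)%E.
  exact: integrableZl.
transitivity (\int[nu]_z ((cst H z)%:E - h^-1%:E * (coboundary u z)%:E))%E.
  apply: ae_eq_integral => //.
  - apply/measurable_EFinP; apply: continuous_phase_measurable.
    exact: torusL_continuous.
  - by apply: emeasurable_funB; [exact: (measurable_int nu iH) | exact: (measurable_int nu iZ)].
  - by apply: filterS aeL => z /= -> _; rewrite EFinB EFinM.
rewrite integralB// integralZl// holonomic_coboundary// mule0 sube0.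
rewrite -[LHS]/(\int[nu]_z cst H%:E z)%E.
by rewrite integral_cst//= probability_setT mule1.
Qed.

Lemma mather_density (nu : probability X R) (r u : T -> R) :
  continuous r -> continuous u -> subaction u ->
  {ae mu, forall z : X, r (flow h z) = r z.1} ->
  (forall A, measurable A -> nu A = \int[mu]_(z in A) (r z.1)%:E)%E ->
  (forall f : X -> R, nu.-integrable setT (EFin \o f) ->
     \int[nu]_z (f z)%:E = \int[mu]_z (f z * r z.1)%:E)%E ->
  mather_measure L h nu.
Proof.
move=> cr cu su rinv nuE nu_int.
have hmu : holonomic h mu by have [] := mu_mather.
have hnu : holonomic h nu.
  move=> phi cphi; rewrite [LHS](nu_int (coboundary phi)); last exact: coboundary_integrable.
  (* By invariance of [r], multiplying the coboundary of [phi] by [r] gives, almost everywhere, the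
     coboundary of [phi * r], which [mu] annihilates. *)
  have cpr : continuous (fun x => phi x * r x).
    by move=> x; apply: (@cvgM _ _ (nbhs x)); [exact: cphi | exact: cr].
  rewrite -(hmu _ cpr); apply: ae_eq_integral => //.
  - apply/measurable_EFinP; apply: measurable_funM.
      by apply: continuous_phase_measurable; exact: coboundary_continuous.
    by apply: continuous_phase_measurable; exact: continuous_comp_fst.
  - apply/measurable_EFinP; apply: continuous_phase_measurable.
    exact: (coboundary_continuous cpr).
  - apply: filterS rinv => z rz _; congr (_%:E).
    by rewrite /coboundary -/(flow h z) rz mulrBl.
split => // nu' hnu'; apply: (@le_trans _ _ (mean_action L mu)); last first.
  by have [_] := mu_mather; apply.
rewrite (mean_action_Hbar cL perL supL h0 mu_mather).
rewrite (holonomic_ae_action cu hnu)//.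
(* The almost sure identity passes to [nu], since [mu]-null sets are [nu]-null. *)
have [A [mA A0 subA]] := ae_torusL_coboundary cL perL supL h0 mu_mather cu su.
exists A; split => //; rewrite nuE//; apply: null_set_integral => //.
apply: measurable_funTS; apply/measurable_EFinP; apply: continuous_phase_measurable.
exact: continuous_comp_fst.
Qed.

Hypothesis mu_unique : forall nu : probability X R, mather_measure L h nu ->
  forall A : set X, measurable A -> nu A = mu A.

Lemma subaction_difference_const (u w : T -> R) :
  continuous u -> subaction u -> continuous w -> subaction w ->
  exists c, forall z, msupport mu z -> u z.1 - w z.1 = c.
Proof.
move=> cu su cw sw.
pose D x := u x - w x.
have cD : continuous D.
  by move=> x; apply: (@cvgB _ _ _ (nbhs x)); [exact: cu | exact: cw].
have [K KP] := torus_continuous_bounded cD.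
(* The shift by [K + 1] makes the function at least 1; dividing by its integral [C] then gives a
   density. *)
pose r0 x := D x + (K + 1).
have cr0 : continuous r0.
  by move=> x; apply: (@cvgD _ _ _ (nbhs x)); [exact: cD | exact: cvg_cst].
have r0_ge1 x : 1 <= r0 x by have := KP x; rewrite ler_norml /r0 => /andP[]; lra.
have cfr0 : continuous (fun z : T * V => r0 z.1) by exact: continuous_comp_fst.
have ir0 : mu.-integrable [set: X] (EFin \o (fun z => r0 z.1)).
  apply: (continuous_phase_integrable mu cfr0 (B := K + (K + 1))) => z.
  have := KP z.1; have := r0_ge1 z.1; rewrite /r0 !ler_norml => h1 /andP[h2 h3].
  by apply/andP; split; lra.
pose C := fine (\int[mu]_z (r0 z.1)%:E)%E.
have CE : (\int[mu]_z (r0 z.1)%:E)%E = C%:E.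
  by rewrite fineK//; exact: integrable_fin_num.
have C1 : 1 <= C.
  rewrite -lee_fin -CE; apply: (@le_trans _ _ (\int[mu]_z cst 1%E z)%E).
    by rewrite integral_cst//= probability_setT mule1.
  apply: ge0_le_integral => //.
  - exact: (measurable_int mu ir0).
  - by move=> z _ /=; rewrite lee_fin.
have C0 : 0 < C by exact: lt_le_trans C1.
pose r x := C^-1 * r0 x.
have cr : continuous r.
  by move=> x; apply: (@cvgM _ _ (nbhs x)); [exact: cvg_cst | exact: cr0].
have mr : measurable_fun [set: X] (fun z => r z.1).
  by apply: continuous_phase_measurable; exact: continuous_comp_fst.
have r_ge0 (z : X) : 0 <= r z.1.
  by rewrite mulr_ge0 ?invr_ge0 ?ltW// (lt_le_trans ltr01).
have ir : (\int[mu]_z (r z.1)%:E = 1)%E.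
  under eq_integral do rewrite EFinM.
  by rewrite integralZl// CE -EFinM mulVf// gt_eqF.
have [nu [nuE nu_int]] := exists_density_measure mr r_ge0 ir.
(* The identities for [u] and [w] express the same [torusL L], so the two coboundaries agree almost
   everywhere. *)
have rinv : {ae mu, forall z : X, r (flow h z) = r z.1}.
  have au := ae_torusL_coboundary cL perL supL h0 mu_mather cu su.
  have aw := ae_torusL_coboundary cL perL supL h0 mu_mather cw sw.
  apply: filterS2 au aw => z -> /(congr1 (fun x => h * (H - x))).
  rewrite !subKr !mulrA divff ?gt_eqF// !mul1r /coboundary /r /r0 /D => e.
  by congr (_ * _); lra.
have nu_mather := mather_density cr cu su rinv nuE nu_int.
have r1 : ae_eq mu [set: X] (fun z => (r z.1)%:E) (cst 1%E).
  apply: integral_ae_eq => //.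
  - under eq_fun do rewrite EFinM.
    exact: integrableZl.
  - by move=> A _ mA; rewrite -nuE// mu_unique// integral_cst// mul1e.
(* Uniqueness of [mu] makes the density 1 almost everywhere, that is, [r0 = C]. *)
exists (C - (K + 1)) => z zs.
apply: (ae_msupport (continuous_comp_fst cD) _ zs).
apply: filterS r1 => y /(_ I) [] /(congr1 (fun x => C * x)).
rewrite /r mulrA divff ?gt_eqF// mul1r mulr1 /r0; lra.
Qed.

End Uniqueness.

(** * Calibrated subactions *)

Section Calibrated.
Variables (R : realType) (N : nat).
Local Notation V := 'rV[R]_N.
Local Notation T := (torus R N).
Local Notation pr := (\pi_(torus R N)%qT : V -> T).
Variable L : V * V -> R.
Hypothesis perL : periodic_in_x L.
Variables h : R.
Hypothesis h0 : 0 < h.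
Local Notation H := (Hbar L h).
Local Notation step := (step L h H).

Lemma path_actionE k p : path_action L h k p = action L h H k p.
Proof. by rewrite /path_action mulr_sumr. Qed.

Lemma step_velocity a v : step a (a + h *: v) = h * torusL L (pr a, v) - h * H.
Proof.
by rewrite /step addrAC subrr add0r scalerA mulVf ?gt_eqF// scale1r torusL_pi// mulrBr.
Qed.

(** The velocity [v] corresponds to the endpoint [b = a + h *: v]. The lower bound property of the
    infimum becomes [subaction], its approximation property [almost_attained]. *)
Lemma calibrated_subactionP (u : T -> R) : calibrated_subaction L h u <->
  [/\ continuous u, subaction L h H u & almost_attained L h H u].
Proof.
pose S x := [set (u (translate x (h *: v)) + h * torusL L (x, v) - h * H)%:E
  | v in [set: V]]%E.
have memS a b : S (pr a) (step a b + u (pr b))%:E.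
  exists (h^-1 *: (b - a)) => //.
  have {3 4}-> : b = a + h *: (h^-1 *: (b - a)).
    by rewrite scalerA divff ?gt_eqF// scale1r addrC subrK.
  by rewrite step_velocity translate_pi; congr (_%:E); lra.
split=> [[cu uS]|[cu sub att]].
  split=> // [a b|a e e0].
    rewrite -lee_fin (uS (pr a)); exact: ereal_inf_lbound (memS a b).
  have : (ereal_inf (S (pr a)) < (u (pr a) + e)%:E)%E.
    by rewrite -uS lte_fin ltrDl.
  move=> /ereal_inf_ltP[_ [v _ <-]]; rewrite lte_fin translate_pi => lt_v.
  by exists (a + h *: v); rewrite step_velocity; lra.
split=> // x; rewrite -/(S x); apply/eqP; rewrite eq_le; apply/andP; split.
  apply/ereal_infP => _ [v _ <-]; rewrite lee_fin -[x]reprK translate_pi.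
  by have := sub (repr x) (repr x + h *: v); rewrite step_velocity; lra.
apply/lee_addgt0Pr => e e0.
have [b bP] := att (repr x) e e0.
have := memS (repr x) b; move: bP; rewrite reprK => bP Sb.
by apply: (le_trans (ereal_inf_lbound Sb)); rewrite -EFinD lee_fin ltW.
Qed.

End Calibrated.

Theorem theorem15 (R : realType) (N : nat) (N_gt0 : (0 < N)%N)
  (L : 'rV[R]_N * 'rV[R]_N -> R) (h : R)
  (L_C2 : C2 L)
  (L_periodic : periodic_in_x L)
  (L_superlinear : superlinear L)
  (L_convex : hessian_v_posdef L)
  (L_semiconcave : semiconcave L)
  (Lx_lipschitz : grad_x_lipschitz_in_v L)
  (h_gt0 : 0 < h)
  (h_graph : graph_property L h)
  (mu : probability (phase R N) R)
  (mu_mather : mather_measure L h mu)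
  (mu_unique : forall nu : probability (phase R N) R, mather_measure L h nu ->
     forall A : set (phase R N), measurable A -> nu A = mu A)
  (mu_supp : fst @` msupport mu = nonwandering L h) :
  exists u : torus R N -> R, calibrated_subaction L h u /\
    forall w : torus R N -> R, calibrated_subaction L h w ->
      exists c : R, forall x, w x = u x + c.
Proof.
have cL : continuous L.
  by move=> z; apply: differentiable_continuous; have [[]] := L_C2.
(* A point of the support projects to a non-wandering point, which serves as the endpoint of the
   potential. *)
have [z0 z0_supp] := msupport_nonempty mu.
have z0_nw : nonwandering L h z0.1 by rewrite -mu_supp; exists z0.
have cycle := cycle_action_ge0 cL L_periodic L_superlinear h_gt0 mu_mather.
have [|u [cu su au]] := exists_fixpoint cL L_periodic L_superlinear h_gt0 cycle
  (z := repr z0.1).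
  move=> e /z0_nw[[|k] [s [p [//= _ sZ p0 pk pe]]]].
  exists k, p; rewrite p0 pk pi_periodic//; split => //.
  by rewrite -path_actionE (le_lt_trans (ler_norm _)).
exists u; split; first by apply/calibrated_subactionP.
move=> w /(calibrated_subactionP L_periodic h_gt0)[cw sw aw].
have [c cP] := subaction_difference_const cL L_periodic L_superlinear h_gt0
  mu_mather mu_unique cw sw cu su.
have cnw z : nonwandering_pt L h (Hbar L h) z -> w z - u z = c.
  move=> nz; have : nonwandering L h z.
    move=> e /nz[k [s [p [k1 sZ p0 pk pe]]]]; exists k, s, p.
    by rewrite path_actionE.
  by rewrite -mu_supp => -[y /cP + <-].
(* The comparison is used in both orders, with the constants [c] and [- c]. *)
exists c => x; apply/eqP; rewrite -subr_eq0 eq_le; apply/andP; split.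
  have := subaction_comparison cL L_periodic L_superlinear h_gt0 cw sw cu su au cnw x.
  lra.
have := subaction_comparison cL L_periodic L_superlinear h_gt0 cu su cw sw aw
  (c := - c) _ x.
have cnw' z : nonwandering_pt L h (Hbar L h) z -> u z - w z = - c.
  by move=> /cnw; lra.
move=> /(_ cnw'); lra.
Qed.
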